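(* Let $\eta\ge1000$ and $k\in\mathbb N$ with $\sqrt[3]{\pi c\eta}\le k\le\sqrt[3]{8000\,c\eta\pi}$. Then every solution of the wave perturbation system at $y$-frequency $\eta$ with data in $X$ satisfies, for all $t\in[t_k,t_{k-1}]$, \[ \|\theta(t)\|_X+\|G(t)\|_X\le e^{3\pi}\bigl(\|\theta(t_k)\|_X+\|G(t_k)\|_X\bigr). \] Consequently, with $k_0$ and $k_1$ the integers obtained by rounding $\sqrt[3]{\pi c\eta}$ and $\sqrt[3]{8000c\eta\pi}$, \[ \|\theta(t_{k_0})\|_X+\|G(t_{k_0})\|_X\le e^{60\pi\sqrt[3]{c\eta}}\bigl(\|\theta(t_{k_1})\|_X+\|G(t_{k_1})\|_X\bigr). \]
   Context: Standing assumptions: fix $\nu>0$, $0<c<0.001$, and a continuous $f:[0,\infty)\to\mathbb R$ with $|f(t)|\le \frac{2c}{1+t^2}$. For a real parameter $\eta$ (the frequency in $y$), $l\in\mathbb Z$ and $t\ge0$ put, when $l\pm1\neq0$, \[ c_l^{\pm}(t)=\frac{c\eta}{(l\pm1)^3}\frac{1}{\bigl(1+(\frac{\eta}{l\pm1}-t)^2\bigr)^2},\qquad d_l^{\pm}(t)=\frac{c\eta}{(l\pm1)^3}\frac{1}{1+(\frac{\eta}{l\pm1}-t)^2}, \] and $c_l^\pm=d_l^\pm=0$ if $l\pm1=0$. The wave perturbation system at $y$-frequency $\eta$ is the linear system for complex sequences $(\theta_l(t))_{l\in\mathbb Z\setminus\{0\}}$, $(G_l(t))_{l\in\mathbb Z\setminus\{0\}}$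 (with $\theta_0\equiv G_0\equiv0$): \[ \dot\theta_l=c_l^+\theta_{l+1}+c_l^-\theta_{l-1}+d_l^+G_{l+1}+d_l^-G_{l-1}, \] \[ \dot G_l=-\nu\bigl(l^2+(\eta-lt)^2\bigr)G_l+\frac{f(t)}{2c}\,i l\bigl(d_l^+G_{l+1}+d_l^-G_{l-1}+c_l^+\theta_{l+1}+c_l^-\theta_{l-1}\bigr)+\frac{2(\frac{\eta}{l}-t)}{(1+(\frac{\eta}{l}-t)^2)^2}\theta_l+\frac{c_l^+\theta_{l+1}+c_l^-\theta_{l-1}+d_l^+G_{l+1}+d_l^-G_{l-1}}{1+(\frac{\eta}{l}-t)^2}. \] The space $X$: fix a weight $\lambda:\mathbb Z\to(0,\infty)$ with $\sup_{l}\lambda(l\pm1)/\lambda(l)<2$; $X$ is the Hilbert space of sequences $u=(u_l)$ with $\|u\|_X^2=\sum_l\lambda(l)^2|u_l|^2<\infty$. Resonant times: for $\eta>0$ and integers $k\ge1$, $t_k=\frac12\bigl(\frac{\eta}{k+1}+\frac{\eta}{k}\bigr)$, $t_0=2\eta$, and $I_k=(t_k,t_{k-1})$. *)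

(* Defs.v *)
From Stdlib Require Export Reals ZArith.
From Coquelicot Require Export Coquelicot.
Open Scope R_scope.

Definition cseq := Z -> C.

(* c_l^{+-}, d_l^{+-}; m = l+1 or l-1; zero when m = 0 *)
Definition cc (c eta : R) (m : Z) (t : R) : R :=
  if Z.eqb m 0 then 0 else
  c * eta / (IZR m) ^ 3 / (1 + (eta / IZR m - t) ^ 2) ^ 2.
Definition dd (c eta : R) (m : Z) (t : R) : R :=
  if Z.eqb m 0 then 0 else
  c * eta / (IZR m) ^ 3 / (1 + (eta / IZR m - t) ^ 2).

Definition rhs_theta (c eta : R) (th G : cseq) (l : Z) (t : R) : C :=
  (RtoC (cc c eta (l+1) t) * th (l+1)%Z + RtoC (cc c eta (l-1) t) * th (l-1)%Z
   + RtoC (dd c eta (l+1) t) * G (l+1)%Z + RtoC (dd c eta (l-1) t) * G (l-1)%Z)%C.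

Definition rhs_G (nu c eta : R) (f : R -> R) (th G : cseq) (l : Z) (t : R) : C :=
  let L := IZR l in
  let q := eta / L - t in
  (RtoC (- nu * (L ^ 2 + (eta - L * t) ^ 2)) * G l
   + RtoC (f t / (2 * c)) * (Ci * RtoC L) *
       (RtoC (dd c eta (l+1) t) * G (l+1)%Z + RtoC (dd c eta (l-1) t) * G (l-1)%Z
        + RtoC (cc c eta (l+1) t) * th (l+1)%Z + RtoC (cc c eta (l-1) t) * th (l-1)%Z)
   + RtoC (2 * q / (1 + q ^ 2) ^ 2) * th l
   + RtoC (1 / (1 + q ^ 2)) * rhs_theta c eta th G l t)%C.

Definition Xterm (lam : Z -> R) (u : cseq) (l : Z) : R := (lam l) ^ 2 * (Cmod (u l)) ^ 2.
Definition inX (lam : Z -> R) (u : cseq) : Prop :=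
  ex_series (fun n : nat => Xterm lam u (Z.of_nat n)) /\
  ex_series (fun n : nat => Xterm lam u (- Z.of_nat (S n))%Z).
Definition normX (lam : Z -> R) (u : cseq) : R :=
  sqrt (Series (fun n : nat => Xterm lam u (Z.of_nat n)) +
        Series (fun n : nat => Xterm lam u (- Z.of_nat (S n))%Z)).

Definition admissible_weight (lam : Z -> R) : Prop :=
  (forall l, 0 < lam l) /\
  exists M, M < 2 /\ forall l, lam (l+1)%Z <= M * lam l /\ lam (l-1)%Z <= M * lam l.

Definition is_solution (nu c eta : R) (f : R -> R) (lam : Z -> R)
    (th G : R -> cseq) : Prop :=
  (forall t, th t 0%Z = 0%C /\ G t 0%Z = 0%C) /\
  (forall t, 0 <= t -> inX lam (th t) /\ inX lam (G t)) /\
  (forall t0, 0 <= t0 -> forall eps, 0 < eps -> exists delta, 0 < delta /\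
     forall t, 0 <= t -> Rabs (t - t0) < delta ->
       normX lam (fun l => th t l - th t0 l)%C < eps /\
       normX lam (fun l => G t l - G t0 l)%C < eps) /\
  (forall l, l <> 0%Z -> forall t, 0 < t ->
     derivable_pt_lim (fun s => Re (th s l)) t (Re (rhs_theta c eta (th t) (G t) l t)) /\
     derivable_pt_lim (fun s => Im (th s l)) t (Im (rhs_theta c eta (th t) (G t) l t)) /\
     derivable_pt_lim (fun s => Re (G s l)) t (Re (rhs_G nu c eta f (th t) (G t) l t)) /\
     derivable_pt_lim (fun s => Im (G s l)) t (Im (rhs_G nu c eta f (th t) (G t) l t))).

Definition tres (eta : R) (k : nat) : R :=
  match k with
  | O => 2 * eta
  | S _ => (eta / INR (k + 1) + eta / INR k) / 2
  end.

Definition cbrt (x : R) : R := Rpower x (1/3).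

Definition round_nat (x : R) : nat := Z.to_nat (Int_part (x + 1/2)).

(* Main.v *)
Require Import Defs.
From Stdlib Require Import Lra Lia Psatz Machin.

(** On [I_k] only the mode [k] is resonant.  With [a = c eta / k^3], [w = 1 / (1 + (eta/k - t)^2)] and
    [eps = 4 c k^2 / eta], every coefficient [|dd m|] is at most [a w + eps], since
    [|eta - m t| >= eta / (2 k)] for [m <> k].  The diffusion has a good sign, the terms with [f] and with
    [1 / (1 + (eta/l - t)^2)] are of order [eps], and [|2 q / (1 + q^2)^2| <= w].  As a shift costs a factor
    less than 2 in [X], [N = |theta| + |G|] satisfies [N' <= ((1 + 4 a) w + 28 eps) N], and Gronwall gives
    a growth factor [exp (PI + 4 PI a + 150 c)] on [I_k].  For infinitely many modes this inequality is proved
    for the regularised norms [sqrt (sum_(|l| <= n) ... + e^2)], integrated, and passed to the limit.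

    The second claim does not follow by chaining the factors [exp (3 PI)], which would give an exponent of about
    [57 PI^(4/3) cbrt (c eta)]; it needs the sharper factor, with [sum 4 PI a] bounded by a telescoping sum. *)

(** * Symmetric partial sums over the integers, their shifts, and Cauchy-Schwarz *)

Fixpoint wsum (F : Z -> R) (n : nat) : R :=
  match n with
  | O => F 0%Z
  | S p => wsum F p + F (Z.of_nat (S p)) + F (- Z.of_nat (S p))%Z
  end.

Lemma wsum_le (F H : Z -> R) (n : nat) :
  (forall l, F l <= H l) -> wsum F n <= wsum H n.
Proof.
  intros h; induction n as [|n IH]; cbn [wsum]; [apply h|].
  pose proof (h (Z.of_nat (S n))); pose proof (h (- Z.of_nat (S n))%Z); lra.
Qed.

Lemma wsum_ext (F H : Z -> R) (n : nat) :
  (forall l, F l = H l) -> wsum F n = wsum H n.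
Proof. intros h; apply Rle_antisym; apply wsum_le; intros l; rewrite h; apply Rle_refl. Qed.

Lemma wsum_nonneg (F : Z -> R) (n : nat) : (forall l, 0 <= F l) -> 0 <= wsum F n.
Proof.
  intros h; induction n as [|n IH]; cbn [wsum]; [apply h|].
  pose proof (h (Z.of_nat (S n))); pose proof (h (- Z.of_nat (S n))%Z); lra.
Qed.

Lemma wsum_plus (F H : Z -> R) (n : nat) :
  wsum (fun l => F l + H l) n = wsum F n + wsum H n.
Proof. induction n as [|n IH]; cbn [wsum]; [|rewrite IH]; ring. Qed.

Lemma wsum_scal (a : R) (F : Z -> R) (n : nat) :
  wsum (fun l => a * F l) n = a * wsum F n.
Proof. induction n as [|n IH]; cbn [wsum]; [|rewrite IH]; ring. Qed.

Lemma wsum_succ (F : Z -> R) (n : nat) :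
  wsum (fun l => F (l + 1)%Z) n = wsum F n + F (Z.of_nat (S n)) - F (- Z.of_nat n)%Z.
Proof.
  induction n as [|n IH]; cbn [wsum].
  - simpl; ring.
  - rewrite IH.
    replace (Z.of_nat (S n) + 1)%Z with (Z.of_nat (S (S n))) by lia.
    replace (- Z.of_nat (S n) + 1)%Z with (- Z.of_nat n)%Z by lia. ring.
Qed.

Lemma wsum_pred (F : Z -> R) (n : nat) :
  wsum (fun l => F (l - 1)%Z) n = wsum F n + F (- Z.of_nat (S n))%Z - F (Z.of_nat n).
Proof.
  induction n as [|n IH]; cbn [wsum].
  - simpl; ring.
  - rewrite IH.
    replace (Z.of_nat (S n) - 1)%Z with (Z.of_nat n) by lia.
    replace (- Z.of_nat (S n) - 1)%Z with (- Z.of_nat (S (S n)))%Z by lia. ring.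
Qed.

Lemma wsum_succ_le (F : Z -> R) (n : nat) :
  (forall l, 0 <= F l) -> wsum (fun l => F (l + 1)%Z) n <= wsum F (S n).
Proof.
  intros h; rewrite wsum_succ; cbn [wsum].
  pose proof (h (- Z.of_nat (S n))%Z); pose proof (h (- Z.of_nat n)%Z); lra.
Qed.

Lemma wsum_pred_le (F : Z -> R) (n : nat) :
  (forall l, 0 <= F l) -> wsum (fun l => F (l - 1)%Z) n <= wsum F (S n).
Proof.
  intros h; rewrite wsum_pred; cbn [wsum].
  pose proof (h (Z.of_nat (S n))%Z); pose proof (h (Z.of_nat n)%Z); lra.
Qed.

(** Adds one coordinate to a Cauchy-Schwarz inequality. The cross term obeys [(2 p a b)^2 <= 4 (q
    b^2) (r a^2) <= (q b^2 + r a^2)^2]. *)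
Lemma cauchy_schwarz_step (p q r a b : R) :
  0 <= q -> 0 <= r -> p ^ 2 <= q * r -> (p + a * b) ^ 2 <= (q + a ^ 2) * (r + b ^ 2).
Proof.
  intros hq hr hp.
  assert (h : 2 * (p * (a * b)) <= q * b ^ 2 + r * a ^ 2).
  { apply Rle_trans with (Rabs (2 * (p * (a * b)))); [apply Rle_abs|].
    rewrite <- (Rabs_pos_eq (q * b ^ 2 + r * a ^ 2)) by nra.
    apply Rsqr_le_abs_0; unfold Rsqr.
    pose proof (pow2_ge_0 (q * b ^ 2 - r * a ^ 2)).
    pose proof (Rmult_le_compat_r _ _ _ (pow2_ge_0 (a * b)) hp).
    nra. }
  nra.
Qed.

Lemma wsum_cauchy_schwarz (u v : Z -> R) (n : nat) :
  wsum (fun l => u l * v l) n <=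
  sqrt (wsum (fun l => u l ^ 2) n) * sqrt (wsum (fun l => v l ^ 2) n).
Proof.
  assert (hs : forall (F : Z -> R) j, 0 <= wsum (fun l => F l ^ 2) j)
    by (intros; apply wsum_nonneg; intros; apply pow2_ge_0).
  assert (h : wsum (fun l => u l * v l) n ^ 2 <=
    wsum (fun l => u l ^ 2) n * wsum (fun l => v l ^ 2) n).
  { induction n as [|n IH]; cbn [wsum]; [right; ring|].
    apply cauchy_schwarz_step.
    - pose proof (hs u n); pose proof (pow2_ge_0 (u (Z.of_nat (S n)))); lra.
    - pose proof (hs v n); pose proof (pow2_ge_0 (v (Z.of_nat (S n)))); lra.
    - apply cauchy_schwarz_step; auto. }
  rewrite <- sqrt_mult by apply hs.
  apply Rle_trans with (Rabs (wsum (fun l => u l * v l) n)); [apply Rle_abs|].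
  rewrite <- sqrt_Rsqr_abs; apply sqrt_le_1_alt.
  rewrite Rsqr_pow2; exact h.
Qed.

(** * Truncated weighted norms and their limit in [X] *)

Lemma Xterm_nonneg (lam : Z -> R) (u : cseq) (l : Z) : 0 <= Xterm lam u l.
Proof. unfold Xterm; pose proof (pow2_ge_0 (lam l)); pose proof (pow2_ge_0 (Cmod (u l))); nra. Qed.

Definition wnorm (lam : Z -> R) (u : cseq) (n : nat) : R := sqrt (wsum (Xterm lam u) n).

(** The negative half starts at [-1], so its index runs one behind that of the nonnegative half;
    hence the form at [S n]. *)
Lemma wsum_sum_n (F : Z -> R) (n : nat) :
  wsum F (S n) = sum_n (fun i => F (Z.of_nat i)) (S n) + sum_n (fun i => F (- Z.of_nat (S i))%Z) n.
Proof.
  rewrite !sum_n_Reals.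
  induction n as [|n IH].
  - cbn [wsum sum_f_R0]; change (Z.of_nat 0) with 0%Z; ring.
  - change (wsum F (S (S n))) with
      (wsum F (S n) + F (Z.of_nat (S (S n))) + F (- Z.of_nat (S (S n)))%Z).
    rewrite IH; cbn [sum_f_R0]; ring.
Qed.

Lemma wsum_lim (F : Z -> R) :
  ex_series (fun n : nat => F (Z.of_nat n)) ->
  ex_series (fun n : nat => F (- Z.of_nat (S n))%Z) ->
  is_lim_seq (wsum F) (Series (fun n : nat => F (Z.of_nat n)) +
                       Series (fun n : nat => F (- Z.of_nat (S n))%Z)).
Proof.
  intros h1 h2.
  apply is_lim_seq_incr_1.
  apply is_lim_seq_ext with (fun n =>
    sum_n (fun i => F (Z.of_nat i)) (S n) + sum_n (fun i => F (- Z.of_nat (S i))%Z) n).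
  { intros n; symmetry; apply wsum_sum_n. }
  apply is_lim_seq_plus'.
  - apply (is_lim_seq_incr_1 (sum_n (fun i => F (Z.of_nat i)))).
    exact (Series_correct _ h1).
  - exact (Series_correct _ h2).
Qed.

Lemma wnorm_lim (lam : Z -> R) (u : cseq) :
  inX lam u -> is_lim_seq (wnorm lam u) (normX lam u).
Proof.
  intros [h1 h2].
  apply (is_lim_seq_continuous sqrt).
  - apply continuity_pt_filterlim, continuous_sqrt.
  - exact (wsum_lim _ h1 h2).
Qed.

Lemma wsum_incr (F : Z -> R) (n : nat) : (forall l, 0 <= F l) -> wsum F n <= wsum F (S n).
Proof.
  intros h; cbn [wsum].
  pose proof (h (Z.of_nat (S n))%Z); pose proof (h (- Z.of_nat (S n))%Z); lra.
Qed.

Lemma wnorm_le_normX (lam : Z -> R) (u : cseq) (n : nat) :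
  inX lam u -> wnorm lam u n <= normX lam u.
Proof.
  intros h.
  apply (is_lim_seq_incr_compare _ _ (wnorm_lim lam u h)).
  intros p; apply sqrt_le_1_alt, wsum_incr, Xterm_nonneg.
Qed.

Lemma normX_nonneg (lam : Z -> R) (u : cseq) : 0 <= normX lam u.
Proof. apply sqrt_pos. Qed.

Lemma wsum_shift_le (F : Z -> R) (s : Z) (n : nat) :
  (-1 <= s <= 1)%Z -> (forall l, 0 <= F l) -> wsum (fun l => F (l + s)%Z) n <= wsum F (S n).
Proof.
  intros hs hF.
  assert (h : s = 1%Z \/ s = 0%Z \/ s = (-1)%Z) by lia.
  destruct h as [-> | [-> | ->]].
  - now apply wsum_succ_le.
  - rewrite (wsum_ext _ F) by (intros l; now rewrite Z.add_0_r).
    now apply wsum_incr.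
  - now apply wsum_pred_le.
Qed.

(** After Cauchy-Schwarz the weight moves along the shift at the price [M]. A shift may leave the
    truncation, so [v] enters with its full norm, while [u] keeps the truncated norm that is later
    divided out. *)
Lemma wsum_pairing (lam : Z -> R) (M : R) (s : Z) (u v : cseq) (n : nat) :
  (-1 <= s <= 1)%Z -> 0 <= M -> (forall l, 0 < lam l) ->
  (forall l, lam l <= M * lam (l + s)%Z) -> inX lam v ->
  wsum (fun l => lam l ^ 2 * (Cmod (u l) * Cmod (v (l + s)%Z))) n <=
  M * (wnorm lam u n * normX lam v).
Proof.
  intros hs hM hl hlM hv.
  rewrite (wsum_ext _ (fun l => (lam l * Cmod (u l)) * (lam l * Cmod (v (l + s)%Z))))
    by (intros; ring).
  eapply Rle_trans; [apply wsum_cauchy_schwarz|].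
  unfold wnorm; rewrite (wsum_ext (Xterm lam u) (fun l => (lam l * Cmod (u l)) ^ 2))
    by (intros; unfold Xterm; ring).
  apply Rle_trans with
    (sqrt (wsum (fun l => (lam l * Cmod (u l)) ^ 2) n) * (M * normX lam v)); [|right; ring].
  apply Rmult_le_compat_l; [apply sqrt_pos|].
  apply Rle_trans with (M * wnorm lam v (S n)).
  - unfold wnorm; rewrite <- (sqrt_pow2 M hM) at 1.
    rewrite <- sqrt_mult by (try apply pow2_ge_0; apply wsum_nonneg, Xterm_nonneg).
    apply sqrt_le_1_alt; rewrite <- wsum_scal.
    eapply Rle_trans; [|apply (wsum_shift_le (fun l => M ^ 2 * Xterm lam v l) s n hs)].
    + apply wsum_le; intros l; cbv beta; unfold Xterm.
      apply Rle_trans with ((M * lam (l + s)%Z) ^ 2 * Cmod (v (l + s)%Z) ^ 2); [|right; ring].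
      rewrite Rpow_mult_distr.
      apply Rmult_le_compat_r; [apply pow2_ge_0|].
      apply pow_incr; split; [left; apply hl | apply hlM].
    + intros l; pose proof (Xterm_nonneg lam v l); pose proof (pow2_ge_0 M); nra.
  - apply Rmult_le_compat_l; [exact hM | now apply wnorm_le_normX].
Qed.

Lemma inX_minus (lam : Z -> R) (u v : cseq) :
  inX lam u -> inX lam v -> inX lam (fun l => u l - v l)%C.
Proof.
  assert (h : forall l, norm (Xterm lam (fun l => u l - v l)%C l) <= 2 * Xterm lam u l + 2 * Xterm lam v l).
  { intros l; change (Rabs (Xterm lam (fun l => u l - v l)%C l) <= 2 * Xterm lam u l + 2 * Xterm lam v l).
    rewrite Rabs_pos_eq by apply Xterm_nonneg; unfold Xterm.
    assert (h := Cmod_triangle (u l) (- v l)%C); rewrite Cmod_opp in h.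
    change (u l + - v l)%C with (u l - v l)%C in h.
    pose proof (Cmod_ge_0 (u l - v l)%C).
    assert (Cmod (u l - v l)%C ^ 2 <= (Cmod (u l) + Cmod (v l)) ^ 2) by (apply pow_incr; lra).
    pose proof (pow2_ge_0 (Cmod (u l) - Cmod (v l))); pose proof (pow2_ge_0 (lam l)); nra. }
  intros [h1 h2] [h3 h4]; split.
  - apply (@ex_series_le R_AbsRing R_CompleteNormedModule _ (fun n =>
      2 * Xterm lam u (Z.of_nat n) + 2 * Xterm lam v (Z.of_nat n)));
      [intros; apply h|].
    apply (@ex_series_plus R_AbsRing R_NormedModule); now apply (@ex_series_scal R_AbsRing R_NormedModule 2).
  - apply (@ex_series_le R_AbsRing R_CompleteNormedModule _ (fun n =>
      2 * Xterm lam u (- Z.of_nat (S n))%Z + 2 * Xterm lam v (- Z.of_nat (S n))%Z));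
      [intros; apply h|].
    apply (@ex_series_plus R_AbsRing R_NormedModule); now apply (@ex_series_scal R_AbsRing R_NormedModule 2).
Qed.

(** Minkowski's inequality for each truncation, passed to the limit. It turns continuity of the
    solution in [X] into continuity of its norm. *)
Lemma normX_le_plus_minus (lam : Z -> R) (u v : cseq) :
  inX lam u -> inX lam v ->
  normX lam u <= normX lam v + normX lam (fun l => u l - v l)%C.
Proof.
  intros hu hv.
  assert (hd := inX_minus lam u v hu hv).
  refine (is_lim_seq_le _ _ _ _ _ (wnorm_lim lam u hu)
    (is_lim_seq_plus' _ _ _ _ (wnorm_lim lam v hv) (wnorm_lim lam _ hd))).
  intros n; unfold wnorm.
  set (d := (fun l => u l - v l)%C).
  assert (hnn : forall w, 0 <= wsum (Xterm lam w) n) by (intros; apply wsum_nonneg, Xterm_nonneg).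
  pose proof (sqrt_pos (wsum (Xterm lam v) n)); pose proof (sqrt_pos (wsum (Xterm lam d) n)).
  rewrite <- (sqrt_pow2 (sqrt (wsum (Xterm lam v) n) + sqrt (wsum (Xterm lam d) n))) by lra.
  apply sqrt_le_1_alt.
  replace ((sqrt (wsum (Xterm lam v) n) + sqrt (wsum (Xterm lam d) n)) ^ 2) with
    (wsum (Xterm lam v) n + wsum (Xterm lam d) n +
     2 * (sqrt (wsum (Xterm lam v) n) * sqrt (wsum (Xterm lam d) n)))
    by (rewrite <- (sqrt_sqrt _ (hnn v)) at 1; rewrite <- (sqrt_sqrt _ (hnn d)) at 1; ring).
  pose proof (wsum_cauchy_schwarz (fun l => lam l * Cmod (v l)) (fun l => lam l * Cmod (d l)) n) as hcs.
  rewrite (wsum_ext (fun l => (lam l * Cmod (v l)) ^ 2) (Xterm lam v)) in hcs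
    by (intros; unfold Xterm; ring).
  rewrite (wsum_ext (fun l => (lam l * Cmod (d l)) ^ 2) (Xterm lam d)) in hcs
    by (intros; unfold Xterm; ring).
  apply Rle_trans with (wsum (Xterm lam v) n + wsum (Xterm lam d) n +
    2 * wsum (fun l => lam l * Cmod (v l) * (lam l * Cmod (d l))) n); [|lra].
  rewrite <- wsum_scal, <- !wsum_plus.
  apply wsum_le; intros l; unfold Xterm.
  assert (h := Cmod_triangle (v l) (d l)).
  replace (v l + d l)%C with (u l) in h by (unfold d; ring).
  assert (Cmod (u l) ^ 2 <= (Cmod (v l) + Cmod (d l)) ^ 2)
    by (apply pow_incr; split; [apply Cmod_ge_0 | exact h]).
  pose proof (pow2_ge_0 (lam l)); nra.
Qed.

(** * Time derivatives of truncated energies *)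

Lemma is_derive_wsum (F : R -> Z -> R) (F' : Z -> R) (t : R) (n : nat) :
  (forall l, is_derive (fun s => F s l) t (F' l)) ->
  is_derive (fun s => wsum (F s) n) t (wsum F' n).
Proof.
  intros h; induction n as [|n IH]; cbn [wsum]; [apply h|].
  apply (is_derive_plus (K := R_AbsRing) (V := R_NormedModule)); [|apply h].
  now apply (is_derive_plus (K := R_AbsRing) (V := R_NormedModule)).
Qed.

(** The real inner product of the plane, that is the real part of [Cconj z * w]: half the derivative
    of the squared modulus of [z] moving with velocity [w]. *)
Definition Cdot (z w : C) : R := Re z * Re w + Im z * Im w.

Lemma is_derive_Xterm (lam : Z -> R) (u : R -> cseq) (z : C) (l : Z) (t : R) :
  derivable_pt_lim (fun s => Re (u s l)) t (Re z) ->
  derivable_pt_lim (fun s => Im (u s l)) t (Im z) ->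
  is_derive (fun s => Xterm lam (u s) l) t (2 * (lam l ^ 2 * Cdot (u t l) z)).
Proof.
  intros h1 h2; apply is_derive_Reals in h1, h2.
  apply is_derive_ext with (fun s => lam l ^ 2 * (Re (u s l) ^ 2 + Im (u s l) ^ 2)).
  { intros s; unfold Xterm; now rewrite Cmod2_alt. }
  unfold Cdot.
  evar_last.
  - apply is_derive_scal, (is_derive_plus (K := R_AbsRing) (V := R_NormedModule));
      apply is_derive_pow; eassumption.
  - unfold plus; cbn -[pow Re Im]; ring.
Qed.

Lemma Cdot_le (z w : C) : Cdot z w <= Cmod z * Cmod w.
Proof.
  replace (Cdot z w) with (Re (Cconj z * w)) by (unfold Cdot; destruct z, w; simpl; ring).
  rewrite <- (Cmod_conj z), <- Cmod_mult.
  eapply Rle_trans; [apply Rle_abs | apply re_le_Cmod].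
Qed.

(** * Resonant windows and bounds for the coefficients on them *)

Definition between_resonances (eta : R) (k : nat) (t : R) : Prop :=
  (1 <= k)%nat /\ tres eta k <= t <= tres eta (k - 1).

(** The window ends are midpoints of neighbouring critical times. Multiplying through by [K + 1] and
    [K - 1] avoids dividing by [K - 1], so that [k = 1] with its special end [2 * eta] fits the same
    form. *)
Lemma between_resonances_bounds (eta t : R) (k : nat) :
  0 < eta -> between_resonances eta k t ->
  1 <= INR k /\ eta + eta / (2 * INR k) <= (INR k + 1) * t /\
  (INR k - 1) * t <= eta - eta / (2 * INR k).
Proof.
  intros he [hk [h1 h2]].
  assert (hK : 1 <= INR k) by (apply (le_INR 1); lia).
  split; [exact hK|].
  split.
  - destruct k as [|k]; [lia|]; unfold tres in h1.
    rewrite plus_INR in h1; change (INR 1) with 1 in h1.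
    set (K := INR (S k)) in *.
    apply (Rmult_le_compat_l (K + 1)) in h1; [|lra].
    replace ((K + 1) * ((eta / (K + 1) + eta / K) / 2)) with (eta + eta / (2 * K)) in h1
      by (field; lra).
    exact h1.
  - destruct k as [|[|k]]; [lia| |].
    + change (INR 1) with 1; lra.
    + replace (S (S k) - 1)%nat with (S k) in h2 by lia; unfold tres in h2.
      rewrite Nat.add_1_r, (S_INR (S k)) in h2; rewrite (S_INR (S k)) in *.
      assert (1 <= INR (S k)) by (apply (le_INR 1); lia).
      (* Here [K] is the predecessor of the window index. *)
      set (K := INR (S k)) in *.
      apply (Rmult_le_compat_l K) in h2; [|lra].
      replace (K * ((eta / (K + 1) + eta / K) / 2)) with (eta - eta / (2 * (K + 1))) in h2
        by (field; lra).
      lra.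
Qed.

Lemma IZR_far (k : nat) (m : Z) :
  m <> Z.of_nat k -> IZR m <= INR k - 1 \/ INR k + 1 <= IZR m.
Proof.
  intros h; rewrite INR_IZR_INZ, <- plus_IZR, <- minus_IZR.
  destruct (Z_lt_le_dec m (Z.of_nat k)); [left|right]; apply IZR_le; lia.
Qed.

Lemma Rabs_IZR_ge_1 (m : Z) : m <> 0%Z -> 1 <= Rabs (IZR m).
Proof. intros h; rewrite <- abs_IZR; apply IZR_le; lia. Qed.

Section Coefficients.

Variables (c eta t : R) (k : nat).
Hypothesis hc : 0 < c.
Hypothesis heta : 0 < eta.
Hypothesis ht : between_resonances eta k t.

Let K := INR k.
Let w := 1 / (1 + (eta / K - t) ^ 2).
Let eps := 4 * c * K ^ 2 / eta.

Lemma between_resonances_facts :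
  1 <= K /\ eta + eta / (2 * K) <= (K + 1) * t /\ (K - 1) * t <= eta - eta / (2 * K) /\
  eta / (2 * K) <= t /\ 0 < t.
Proof.
  destruct (between_resonances_bounds eta t k heta ht) as [h [h1 h2]]; fold K in h, h1, h2.
  do 3 (split; [assumption|]).
  assert (0 < eta / (2 * K)) by (apply Rdiv_lt_0_compat; lra).
  assert (0 < t) by nra.
  split; [|assumption].
  apply Rmult_le_reg_l with (2 * K); [lra|].
  replace (2 * K * (eta / (2 * K))) with eta by (field; lra).
  nra.
Qed.

(** As [t > 0], [eta - m t] is monotone in [m], so the worst cases are [m = k - 1] and [m = k + 1],
    which are the window bounds. *)
Lemma eta_mul_far (m : Z) : m <> Z.of_nat k -> eta / (2 * K) <= Rabs (eta - IZR m * t).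
Proof.
  intros hm; destruct between_resonances_facts as [h [h1 [h2 [h3 h4]]]].
  destruct (IZR_far k m hm) as [h5|h5]; fold K in h5.
  - eapply Rle_trans; [|apply Rle_abs]. nra.
  - rewrite Rabs_minus_sym; eapply Rle_trans; [|apply Rle_abs]. nra.
Qed.

(** Since the window ends are midpoints, [eta / k] is the critical time nearest to [t], and any
    other one is at least half the smaller adjacent gap [eta / (k (k + 1))] away. *)
Lemma q_far (m : Z) :
  m <> 0%Z -> m <> Z.of_nat k ->
  Rabs (eta / K - t) <= Rabs (eta / IZR m - t) /\
  eta / (2 * K * (K + 1)) <= Rabs (eta / IZR m - t).
Proof.
  intros h0 hm; destruct between_resonances_facts as [h [h1 [h2 [h3 h4]]]].
  assert (hK : eta / (2 * K * (K + 1)) = (eta / K - eta / (K + 1)) / 2) by (field; lra).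
  assert (hA : eta / K + eta / (K + 1) <= 2 * t).
  { apply Rmult_le_reg_l with (K + 1); [lra|].
    replace ((K + 1) * (eta / K + eta / (K + 1))) with (2 * (eta + eta / (2 * K))) by (field; lra).
    lra. }
  assert (hp : 0 < eta / (K + 1)) by (apply Rdiv_lt_0_compat; lra).
  assert (hd : eta / (K + 1) <= eta / K).
  { apply Rmult_le_compat_l; [lra|]; apply Rinv_le_contravar; lra. }
  destruct (IZR_far k m hm) as [h5|h5]; fold K in h5.
  - destruct (Z_lt_le_dec m 0) as [hneg|hpos].
    (* For negative [m] the critical time is negative, so its distance to [t] exceeds [t], which
       already dominates both quantities. *)
    + apply IZR_lt in hneg.
      assert (eta / IZR m < 0).
      { unfold Rdiv; assert (/ IZR m < 0) by now apply Rinv_lt_0_compat. nra. }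
      rewrite (Rabs_left (eta / IZR m - t)) by lra.
      split; [|lra]. apply Rabs_le; lra.
    + assert (h6 : 1 <= IZR m) by (apply (IZR_le 1); lia).
      assert (h7 : eta / (K - 1) <= eta / IZR m).
      { apply Rmult_le_compat_l; [lra|]; apply Rinv_le_contravar; lra. }
      assert (h8 : 2 * t <= eta / K + eta / (K - 1)).
      { apply Rmult_le_reg_l with (K - 1); [lra|].
        replace ((K - 1) * (eta / K + eta / (K - 1))) with (2 * (eta - eta / (2 * K)))
          by (field; lra).
        lra. }
      (* Convexity of [1 / x]: the gap above [eta / K] is at least the gap below it. *)
      assert (h9 : eta / K - eta / (K + 1) <= eta / (K - 1) - eta / K).
      { replace (eta / (K - 1) - eta / K) with
          (eta / K - eta / (K + 1) + 2 * eta / ((K - 1) * K * (K + 1))) by (field; lra).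
        assert (0 < 2 * eta / ((K - 1) * K * (K + 1))); [|lra].
        apply Rdiv_lt_0_compat; [lra|]; repeat apply Rmult_lt_0_compat; lra. }
      rewrite (Rabs_pos_eq (eta / IZR m - t)) by lra.
      split; [|lra]. apply Rabs_le; lra.
  - assert (h6 : eta / IZR m <= eta / (K + 1)).
    { apply Rmult_le_compat_l; [lra|]; apply Rinv_le_contravar; lra. }
    rewrite (Rabs_left1 (eta / IZR m - t)) by lra.
    split; [|lra]. apply Rabs_le; lra.
Qed.

Lemma q_resonant_le (m : Z) :
  m <> 0%Z -> 1 / (1 + (eta / IZR m - t) ^ 2) <= w.
Proof.
  intros h0; unfold w.
  destruct (Z.eq_dec m (Z.of_nat k)) as [->|hm].
  - rewrite <- INR_IZR_INZ; apply Rle_refl.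
  - apply Rmult_le_compat_l; [lra|].
    apply Rinv_le_contravar; [pose proof (pow2_ge_0 (eta / K - t)); lra|].
    destruct (q_far m h0 hm) as [h _].
    apply Rplus_le_compat_l.
    rewrite <- !Rsqr_pow2; now apply Rsqr_le_abs_1.
Qed.

(** In this product form any lower bound for the denominator yields an upper bound for [dd] through
    [quotient_le]. *)
Lemma dd_abs (m : Z) : m <> 0%Z ->
  Rabs (dd c eta m t) * (Rabs (IZR m) ^ 3 * (1 + (eta / IZR m - t) ^ 2)) = c * eta.
Proof.
  intros h0; unfold dd; rewrite (proj2 (Z.eqb_neq m 0) h0).
  pose proof (pow2_ge_0 (eta / IZR m - t)).
  assert (hp : 0 < 1 + (eta / IZR m - t) ^ 2) by lra.
  pose proof (Rabs_IZR_ge_1 m h0).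
  unfold Rdiv; rewrite !Rabs_mult, !Rabs_inv, <- RPow_abs.
  rewrite (Rabs_pos_eq c), (Rabs_pos_eq eta) by lra.
  fold (Rdiv eta (IZR m)).
  rewrite (Rabs_pos_eq (1 + (eta / IZR m - t) ^ 2)) by lra.
  set (q := 1 + (eta / IZR m - t) ^ 2) in *; clearbody q.
  field; lra.
Qed.

Lemma quotient_le (y D D0 b : R) : 0 < D0 -> D0 <= D -> 0 <= y -> y * D = b -> y <= b / D0.
Proof.
  intros h1 h2 h3 h4.
  apply Rmult_le_reg_r with D0; [exact h1|].
  replace (b / D0 * D0) with b by (field; lra). nra.
Qed.

Lemma eps_pos : 0 < eps.
Proof.
  destruct between_resonances_facts as [h _].
  unfold eps; apply Rdiv_lt_0_compat; [|lra].
  repeat apply Rmult_lt_0_compat; try lra; apply pow_lt; lra.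
Qed.

(** The denominator [|m|^3 (1 + q^2)] is at least [m^2 q^2 = (eta - m t)^2], which [eta_mul_far]
    bounds from below. *)
Lemma dd_far (m : Z) : m <> Z.of_nat k -> Rabs (dd c eta m t) <= eps.
Proof.
  intros hm; destruct between_resonances_facts as [h _].
  destruct (Z.eq_dec m 0) as [->|h0].
  { unfold dd; simpl; rewrite Rabs_R0; left; apply eps_pos. }
  replace eps with (c * eta / ((eta / (2 * K)) ^ 2)) by (unfold eps; field; lra).
  eapply quotient_le; [| | apply Rabs_pos | apply (dd_abs m h0)].
  - apply pow_lt, Rdiv_lt_0_compat; lra.
  - pose proof (Rabs_IZR_ge_1 m h0) as h1.
    assert (h2 := eta_mul_far m hm).
    assert (h3 : Rabs (eta - IZR m * t) ^ 2 = Rabs (IZR m) ^ 2 * (eta / IZR m - t) ^ 2).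
    { rewrite !pow2_abs; field; now apply not_0_IZR. }
    assert (0 <= eta / (2 * K)) by (left; apply Rdiv_lt_0_compat; lra).
    assert (h4 : (eta / (2 * K)) ^ 2 <= Rabs (eta - IZR m * t) ^ 2) by (apply pow_incr; lra).
    rewrite h3 in h4.
    set (r := Rabs (IZR m)) in *; set (q := (eta / IZR m - t) ^ 2) in *.
    assert (0 <= q) by apply pow2_ge_0.
    assert (r ^ 2 * q <= r ^ 3 * (1 + q)); [|lra].
    replace (r ^ 3 * (1 + q)) with (r ^ 2 * q + r ^ 2 * q * (r - 1) + r ^ 3) by ring.
    assert (0 <= r ^ 2 * q * (r - 1)).
    { apply Rmult_le_pos; [apply Rmult_le_pos; [apply pow2_ge_0 | assumption] | lra]. }
    assert (0 < r ^ 3) by (apply pow_lt; lra). lra.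
Qed.

Lemma dd_le (m : Z) : Rabs (dd c eta m t) <= c * eta / K ^ 3 * w + eps.
Proof.
  destruct between_resonances_facts as [h _]; pose proof eps_pos.
  assert (hw : 0 < w).
  { unfold w; apply Rdiv_lt_0_compat; pose proof (pow2_ge_0 (eta / K - t)); lra. }
  assert (ha : 0 < c * eta / K ^ 3) by (apply Rdiv_lt_0_compat; [nra | apply pow_lt; lra]).
  destruct (Z.eq_dec m (Z.of_nat k)) as [->|hm].
  - unfold dd; rewrite (proj2 (Z.eqb_neq _ 0)) by (destruct ht; lia).
    rewrite <- INR_IZR_INZ; fold K.
    replace (c * eta / K ^ 3 / (1 + (eta / K - t) ^ 2)) with (c * eta / K ^ 3 * w)
      by (unfold w, Rdiv; ring).
    rewrite Rabs_pos_eq; nra.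
  - pose proof (dd_far m hm); nra.
Qed.

(** The extra factor [1 / (1 + q^2)] is at most 1, so every estimate of [dd] serves for [cc] too. *)
Lemma cc_le_dd (m : Z) : Rabs (cc c eta m t) <= Rabs (dd c eta m t).
Proof.
  unfold cc, dd; destruct (Z.eqb m 0); [apply Rle_refl|].
  pose proof (pow2_ge_0 (eta / IZR m - t)).
  set (x := c * eta / IZR m ^ 3); set (q := 1 + (eta / IZR m - t) ^ 2).
  assert (1 <= q) by (unfold q; lra).
  unfold Rdiv; rewrite !(Rabs_mult x).
  apply Rmult_le_compat_l; [apply Rabs_pos|].
  rewrite !Rabs_pos_eq; try (left; apply Rinv_0_lt_compat; nra).
  apply Rinv_le_contravar; nra.
Qed.

(* The unbounded factor [l] is absorbed by [m^-3], as [|l| <= 2 |m|]; the decay of [f] gives the smallness. *)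
Lemma forcing_coefficient_le (ft : R) (l m : Z) :
  Rabs ft <= 2 * c / (1 + t ^ 2) -> (-1 <= m - l <= 1)%Z ->
  Rabs (ft / (2 * c)) * Rabs (IZR l) * Rabs (dd c eta m t) <= 2 * eps.
Proof.
  intros hf hml; destruct between_resonances_facts as [h [_ [_ [h3 h4]]]]; pose proof eps_pos.
  destruct (Z.eq_dec m 0) as [->|h0].
  { unfold dd; simpl; rewrite Rabs_R0; lra. }
  assert (hl : Rabs (IZR l) <= 2 * Rabs (IZR m)).
  { rewrite <- !abs_IZR, <- mult_IZR; apply IZR_le; lia. }
  assert (hm1 := Rabs_IZR_ge_1 m h0).
  assert (hF : Rabs (ft / (2 * c)) <= / (1 + t ^ 2)).
  { unfold Rdiv; rewrite Rabs_mult, Rabs_inv, (Rabs_pos_eq (2 * c)) by lra.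
    replace (/ (1 + t ^ 2)) with (2 * c / (1 + t ^ 2) * / (2 * c)) by (field; split; nra).
    apply Rmult_le_compat_r; [left; apply Rinv_0_lt_compat; lra | exact hf]. }
  assert (ht2 : / (1 + t ^ 2) <= / ((eta / (2 * K)) ^ 2)).
  { assert (0 < eta / (2 * K)) by (apply Rdiv_lt_0_compat; lra).
    apply Rinv_le_contravar; nra. }
  assert (hD : Rabs (IZR m) * Rabs (dd c eta m t) <= c * eta).
  { rewrite <- (dd_abs m h0).
    pose proof (pow2_ge_0 (eta / IZR m - t)).
    set (r := Rabs (IZR m)) in *; set (q := (eta / IZR m - t) ^ 2) in *.
    rewrite Rmult_comm; apply Rmult_le_compat_l; [apply Rabs_pos|].
    replace (r ^ 3 * (1 + q)) with (r + r * (r ^ 2 - 1) + r ^ 3 * q) by ring.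
    assert (0 <= r ^ 3 * q) by (apply Rmult_le_pos; [apply pow_le|]; lra).
    nra. }
  replace (2 * eps) with (/ ((eta / (2 * K)) ^ 2) * (2 * (c * eta))) by (unfold eps; field; lra).
  rewrite Rmult_assoc.
  apply Rmult_le_compat; [apply Rabs_pos | | lra |].
  - apply Rmult_le_pos; apply Rabs_pos.
  - apply Rle_trans with (2 * Rabs (IZR m) * Rabs (dd c eta m t)); [|nra].
    apply Rmult_le_compat_r; [apply Rabs_pos | exact hl].
Qed.

(** Since [m <> l], the two factors cannot both be resonant. If [m <> k], [dd_far] suffices; if
    [m = k], then [l <> k], [q_far] makes the first factor small, and [(K + 1)^2 <= 4 K^3] gives the
    constant 4. *)
Lemma nonresonant_product_le (l m : Z) :
  l <> 0%Z -> m <> l ->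
  1 / (1 + (eta / IZR l - t) ^ 2) * Rabs (dd c eta m t) <= 4 * eps.
Proof.
  intros h0 hml; destruct between_resonances_facts as [h _]; pose proof eps_pos as he.
  pose proof (pow2_ge_0 (eta / IZR l - t)) as hq.
  destruct (Z.eq_dec m (Z.of_nat k)) as [hm|hm].
  - destruct (q_far l h0) as [_ h1]; [congruence|].
    assert (hd : Rabs (dd c eta m t) <= c * eta / K ^ 3).
    { assert (hm0 : m <> 0%Z) by (subst; destruct ht; lia).
      eapply quotient_le; [apply pow_lt; lra | | apply Rabs_pos | apply (dd_abs m hm0)].
      rewrite hm, <- INR_IZR_INZ; fold K; rewrite (Rabs_pos_eq K) by lra.
      pose proof (pow2_ge_0 (eta / K - t)).
      assert (0 < K ^ 3) by (apply pow_lt; lra). nra. }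
    assert (hpos : 0 < eta / (2 * K * (K + 1))).
    { apply Rdiv_lt_0_compat; [lra|]. apply Rmult_lt_0_compat; lra. }
    assert (hi : 1 / (1 + (eta / IZR l - t) ^ 2) <= / ((eta / (2 * K * (K + 1))) ^ 2)).
    { unfold Rdiv at 1; rewrite Rmult_1_l; apply Rinv_le_contravar; [now apply pow_lt|].
      apply Rle_trans with (Rabs (eta / IZR l - t) ^ 2).
      - apply pow_incr; lra.
      - rewrite pow2_abs; lra. }
    apply Rle_trans with (/ ((eta / (2 * K * (K + 1))) ^ 2) * (c * eta / K ^ 3)).
    { apply Rmult_le_compat; [|apply Rabs_pos | exact hi | exact hd].
      left; apply Rdiv_lt_0_compat; lra. }
    replace (/ (eta / (2 * K * (K + 1))) ^ 2 * (c * eta / K ^ 3)) with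
      (4 * c / (eta * K) * (K + 1) ^ 2) by (field; lra).
    replace (4 * eps) with (4 * c / (eta * K) * (4 * K ^ 3)) by (unfold eps; field; lra).
    apply Rmult_le_compat_l.
    + left; apply Rdiv_lt_0_compat; nra.
    + assert (K ^ 2 <= K ^ 3) by nra. nra.
  - pose proof (dd_far m hm); pose proof (Rabs_pos (dd c eta m t)).
    assert (1 / (1 + (eta / IZR l - t) ^ 2) <= 1).
    { apply Rmult_le_reg_r with (1 + (eta / IZR l - t) ^ 2); [lra|].
      unfold Rdiv; rewrite Rmult_assoc, Rinv_l; lra. }
    assert (0 < 1 / (1 + (eta / IZR l - t) ^ 2)) by (apply Rdiv_lt_0_compat; lra).
    nra.
Qed.

(** From [2 |q| <= 1 + q^2] and the comparison with the resonant mode. *)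
Lemma transport_coefficient_le (l : Z) :
  l <> 0%Z ->
  Rabs (2 * (eta / IZR l - t) / (1 + (eta / IZR l - t) ^ 2) ^ 2) <= w.
Proof.
  intros h0; eapply Rle_trans; [|apply (q_resonant_le l h0)].
  set (q := eta / IZR l - t); clearbody q.
  pose proof (pow2_ge_0 q).
  assert (0 < (1 + q ^ 2) ^ 2) by (apply pow_lt; lra).
  unfold Rdiv at 1; rewrite Rabs_mult, Rabs_inv, (Rabs_pos_eq ((1 + q ^ 2) ^ 2)) by lra.
  replace (1 / (1 + q ^ 2)) with ((1 + q ^ 2) * / (1 + q ^ 2) ^ 2) by (field; lra).
  apply Rmult_le_compat_r; [left; now apply Rinv_0_lt_compat|].
  pose proof (pow2_ge_0 (q - 1)); pose proof (pow2_ge_0 (q + 1)).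
  apply Rabs_le; lra.
Qed.

End Coefficients.

(** * Symmetry of the distance, monotonicity from a derivative sign, and Gronwall *)

Lemma normX_minus_sym (lam : Z -> R) (u v : cseq) :
  normX lam (fun l => u l - v l)%C = normX lam (fun l => v l - u l)%C.
Proof.
  assert (h : forall l, Xterm lam (fun l => u l - v l)%C l = Xterm lam (fun l => v l - u l)%C l).
  { intros l; unfold Xterm; rewrite <- (Cmod_opp (v l - u l)%C).
    replace (- (v l - u l))%C with (u l - v l)%C by ring; reflexivity. }
  unfold normX; f_equal; f_equal; apply Series_ext; intros n; apply h.
Qed.

Lemma nonincreasing_of_derive_le_0 (F F' : R -> R) (a b : R) :
  a <= b -> (forall x, a <= x <= b -> is_derive F x (F' x)) ->
  (forall x, a <= x <= b -> F' x <= 0) -> F b <= F a.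
Proof.
  intros hab hd hn.
  destruct (MVT_gen F a b F') as [z [hz he]];
    rewrite ?Rmin_left, ?Rmax_right in * by assumption.
  - intros x hx; apply hd; lra.
  - intros x hx; apply derivable_continuous_pt; exists (F' x).
    now apply is_derive_Reals, hd.
  - specialize (hn z hz); nra.
Qed.

Lemma is_derive_RInt_pos (phi : R -> R) (a t : R) :
  (forall s, 0 < s -> continuous phi s) -> 0 < a -> 0 < t ->
  is_derive (fun s => RInt phi a s) t (phi t).
Proof.
  intros hc ha ht.
  apply (is_derive_RInt phi (fun s => RInt phi a s) a t); [|now apply hc].
  exists (mkposreal t ht); intros s hs.
  apply (@RInt_correct R_CompleteNormedModule), (@ex_RInt_continuous R_CompleteNormedModule).
  intros z hz; apply hc.
  assert (0 < s).
  { change (Rabs (s - t) < t) in hs; apply Rabs_def2 in hs; lra. }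
  assert (0 < Rmin a s) by (apply Rmin_glb_lt; assumption). lra.
Qed.

(** [N] is only continuous, so the argument runs on the differentiable majorant [Phi], the right
    side of the integral inequality: [Phi exp(- Gam)] is nonincreasing. [Gam] may be any primitive
    of [g], which allows an explicit one. *)
Lemma gronwall (N g Gam : R -> R) (a b : R) :
  0 < a -> a <= b ->
  (forall s, 0 < s -> continuous N s) -> (forall s, 0 < s -> continuous g s) ->
  (forall s, is_derive Gam s (g s)) -> (forall s, 0 <= g s) ->
  (forall t, a <= t <= b -> N t <= N a + RInt (fun s => g s * N s) a t) ->
  N b <= N a * exp (Gam b - Gam a).
Proof.
  intros ha hab hN hg hG hg0 hint.
  set (Phi := fun t => N a + RInt (fun s => g s * N s) a t).
  assert (hPhi : forall t, a <= t <= b -> is_derive Phi t (g t * N t)).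
  { intros t ht; unfold Phi.
    replace (g t * N t) with (0 + g t * N t) by ring.
    apply (is_derive_plus (K := R_AbsRing) (V := R_NormedModule)); [apply (is_derive_const (V := R_NormedModule))|].
    apply (is_derive_RInt_pos (fun s => g s * N s)); [|lra|lra].
    intros s hs; apply (continuous_mult (K := R_AbsRing)); auto. }
  assert (h : Phi b * exp (- Gam b) <= Phi a * exp (- Gam a)).
  { apply (nonincreasing_of_derive_le_0 (fun t => Phi t * exp (- Gam t))
      (fun t => g t * N t * exp (- Gam t) + Phi t * (- g t * exp (- Gam t))) a b hab).
    - intros t ht.
      apply (is_derive_mult (K := R_AbsRing) Phi (fun t => exp (- Gam t)));
        [now apply hPhi | | intros; apply Rmult_comm].
      apply (is_derive_comp exp (fun t => - Gam t)); [apply is_derive_exp|].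
      now apply (is_derive_opp (K := R_AbsRing) (V := R_NormedModule)).
    - intros t ht.
      assert (h := hint t ht); fold (Phi t) in h.
      replace (g t * N t * exp (- Gam t) + Phi t * (- g t * exp (- Gam t))) with
        (- (g t * (Phi t - N t) * exp (- Gam t))) by ring.
      assert (0 <= g t * (Phi t - N t) * exp (- Gam t)); [|lra].
      apply Rmult_le_pos; [apply Rmult_le_pos; [apply hg0 | lra] | left; apply exp_pos]. }
  assert (h0 : Phi a = N a).
  { unfold Phi; rewrite RInt_point; unfold zero; simpl; ring. }
  apply Rle_trans with (Phi b); [apply hint; lra|].
  rewrite h0 in h.
  replace (N a * exp (Gam b - Gam a)) with (N a * exp (- Gam a) * exp (Gam b))
    by (rewrite Rmult_assoc, <- exp_plus; f_equal; f_equal; ring).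
  replace (Phi b) with (Phi b * exp (- Gam b) * exp (Gam b))
    by (rewrite Rmult_assoc, <- exp_plus, Rplus_opp_l, exp_0; ring).
  apply Rmult_le_compat_r; [left; apply exp_pos | exact h].
Qed.

(** * Energy estimates at a fixed time *)

Definition neighbours (th G : cseq) (l : Z) : R :=
  Cmod (th (l + 1)%Z) + Cmod (th (l - 1)%Z) + Cmod (G (l + 1)%Z) + Cmod (G (l - 1)%Z).

(** Each of [th] and [G] is shifted both ways, and a shift costs [M < 2]; hence the factor 4. *)
Lemma wsum_neighbours (lam : Z -> R) (u th G : cseq) (n : nat) :
  admissible_weight lam -> inX lam th -> inX lam G ->
  wsum (fun l => lam l ^ 2 * (Cmod (u l) * neighbours th G l)) n <=
  4 * wnorm lam u n * (normX lam th + normX lam G).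
Proof.
  intros [hl [M [hM2 hM]]] hth hG.
  assert (hM0 : 0 <= M).
  { pose proof (hl 0%Z); pose proof (hl (0 + 1)%Z); destruct (hM 0%Z) as [h _]; nra. }
  assert (hp : forall l, lam l <= M * lam (l + 1)%Z).
  { intros l; destruct (hM (l + 1)%Z) as [_ h].
    now replace (l + 1 - 1)%Z with l in h by lia. }
  assert (hm : forall l, lam l <= M * lam (l + -1)%Z).
  { intros l; destruct (hM (l - 1)%Z) as [h _].
    now replace (l - 1 + 1)%Z with l in h by lia. }
  assert (h1 := wsum_pairing lam M 1 u th n ltac:(lia) hM0 hl hp hth).
  assert (h2 := wsum_pairing lam M 1 u G n ltac:(lia) hM0 hl hp hG).
  assert (h3 := wsum_pairing lam M (-1) u th n ltac:(lia) hM0 hl hm hth).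
  assert (h4 := wsum_pairing lam M (-1) u G n ltac:(lia) hM0 hl hm hG).
  rewrite (wsum_ext _ (fun l =>
    lam l ^ 2 * (Cmod (u l) * Cmod (th (l + 1)%Z)) + lam l ^ 2 * (Cmod (u l) * Cmod (th (l + -1)%Z)) +
    lam l ^ 2 * (Cmod (u l) * Cmod (G (l + 1)%Z)) + lam l ^ 2 * (Cmod (u l) * Cmod (G (l + -1)%Z))))
    by (intros l; unfold neighbours, Z.sub; simpl Z.opp; ring).
  rewrite !wsum_plus.
  assert (h : 0 <= wnorm lam u n * (normX lam th + normX lam G)).
  { apply Rmult_le_pos; [apply sqrt_pos|].
    pose proof (normX_nonneg lam th); pose proof (normX_nonneg lam G); lra. }
  apply Rle_trans with (2 * M * (wnorm lam u n * (normX lam th + normX lam G))); [lra|].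
  nra.
Qed.

(** The prefactor [kappa] lets one bound serve all three occurrences of the coupling: with 1, with
    [|f l / (2 c)|], and with [1 / (1 + q^2)]. The last two need the smallness of a product of
    coefficients. *)
Lemma Cmod_rhs_theta_le (c eta t kappa D : R) (th G : cseq) (l : Z) :
  0 <= kappa ->
  (forall m, m = (l + 1)%Z \/ m = (l - 1)%Z ->
     kappa * Rabs (cc c eta m t) <= D /\ kappa * Rabs (dd c eta m t) <= D) ->
  kappa * Cmod (rhs_theta c eta th G l t) <= D * neighbours th G l.
Proof.
  intros hk h.
  destruct (h (l + 1)%Z) as [h1 h2]; [now left|].
  destruct (h (l - 1)%Z) as [h3 h4]; [now right|].
  unfold rhs_theta, neighbours.
  set (z1 := th (l + 1)%Z); set (z2 := th (l - 1)%Z); set (z3 := G (l + 1)%Z); set (z4 := G (l - 1)%Z).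
  apply Rle_trans with (kappa * (Rabs (cc c eta (l + 1) t) * Cmod z1 + Rabs (cc c eta (l - 1) t) * Cmod z2
    + Rabs (dd c eta (l + 1) t) * Cmod z3 + Rabs (dd c eta (l - 1) t) * Cmod z4)).
  - apply Rmult_le_compat_l; [exact hk|].
    rewrite <- !Cmod_R, <- !Cmod_mult.
    do 3 (eapply Rle_trans; [apply Cmod_triangle | apply Rplus_le_compat_r]).
    apply Rle_refl.
  - pose proof (Cmod_ge_0 z1); pose proof (Cmod_ge_0 z2);
    pose proof (Cmod_ge_0 z3); pose proof (Cmod_ge_0 z4).
    assert (h5 := Rmult_le_compat_r _ _ _ H h1); assert (h6 := Rmult_le_compat_r _ _ _ H0 h3).
    assert (h7 := Rmult_le_compat_r _ _ _ H1 h2); assert (h8 := Rmult_le_compat_r _ _ _ H2 h4).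
    lra.
Qed.

(** The damping contributes [a |z|^2 <= 0], so the diffusion coefficient, unbounded in [l], is
    dropped and never estimated. *)
Lemma Cdot_damped_le (a : R) (z r : C) : a <= 0 -> Cdot z (RtoC a * z + r)%C <= Cmod z * Cmod r.
Proof.
  intros ha; apply Rle_trans with (Cdot z r); [|apply Cdot_le].
  unfold Cdot; destruct z as [x y], r as [p q]; simpl.
  assert (0 <= - a * (x ^ 2 + y ^ 2)).
  { apply Rmult_le_pos; [lra|]; pose proof (pow2_ge_0 x); pose proof (pow2_ge_0 y); lra. }
  lra.
Qed.

Section Energy.

Variables (nu c eta : R) (f : R -> R) (lam : Z -> R) (k : nat) (t : R) (th G : cseq).
Hypothesis hnu : 0 < nu.
Hypothesis hc : 0 < c.
Hypothesis heta : 0 < eta.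
Hypothesis hf : Rabs (f t) <= 2 * c / (1 + t ^ 2).
Hypothesis hlam : admissible_weight lam.
Hypothesis ht : between_resonances eta k t.
Hypothesis hth : inX lam th.
Hypothesis hG : inX lam G.
Hypothesis hG0 : G 0%Z = 0%C.

Let a := c * eta / INR k ^ 3.
Let w := 1 / (1 + (eta / INR k - t) ^ 2).
Let eps := 4 * c * INR k ^ 2 / eta.

Lemma w_pos : 0 < w.
Proof. unfold w; apply Rdiv_lt_0_compat; pose proof (pow2_ge_0 (eta / INR k - t)); lra. Qed.

Lemma theta_energy_le (n : nat) :
  wsum (fun l => lam l ^ 2 * Cdot (th l) (rhs_theta c eta th G l t)) n <=
  wnorm lam th n * (4 * (a * w + eps) * (normX lam th + normX lam G)).
Proof.
  apply Rle_trans with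
    (wsum (fun l => (a * w + eps) * (lam l ^ 2 * (Cmod (th l) * neighbours th G l))) n).
  - apply wsum_le; intros l.
    assert (h : Cmod (rhs_theta c eta th G l t) <= (a * w + eps) * neighbours th G l).
    { rewrite <- (Rmult_1_l (Cmod _)); apply Cmod_rhs_theta_le; [lra|].
      intros m _; rewrite !Rmult_1_l.
      assert (hd := dd_le c eta t k hc heta ht m).
      split; [eapply Rle_trans; [apply cc_le_dd | exact hd] | exact hd]. }
    pose proof (Cdot_le (th l) (rhs_theta c eta th G l t)).
    pose proof (Rmult_le_compat_l _ _ _ (Cmod_ge_0 (th l)) h).
    pose proof (pow2_ge_0 (lam l)).
    apply Rle_trans with (lam l ^ 2 * (Cmod (th l) * ((a * w + eps) * neighbours th G l)));
      [apply Rmult_le_compat_l; lra | right; ring].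
  - rewrite wsum_scal.
    assert (hD : 0 <= a * w + eps).
    { eapply Rle_trans; [apply (Rabs_pos (dd c eta 0 t))|]; exact (dd_le c eta t k hc heta ht 0). }
    pose proof (Rmult_le_compat_l _ _ _ hD (wsum_neighbours lam th th G n hlam hth hG)). lra.
Qed.

(** The constant 6 collects 2 from the forcing by [f] and 4 from the nonresonant products; [w]
    bounds the transport term. *)
Lemma Cdot_rhs_G_le (l : Z) :
  Cdot (G l) (rhs_G nu c eta f th G l t) <=
  Cmod (G l) * (6 * eps * neighbours th G l + w * Cmod (th l)).
Proof.
  destruct (Z.eq_dec l 0) as [->|hl].
  (* At mode 0 the formula contains [eta / 0]; there [G] vanishes and both sides are 0. *)
  { rewrite hG0, Cmod_0; unfold Cdot; simpl; lra. }
  set (L := IZR l); set (q := eta / L - t); set (T := rhs_theta c eta th G l t).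
  replace (rhs_G nu c eta f th G l t) with
    (RtoC (- nu * (L ^ 2 + (eta - L * t) ^ 2)) * G l
     + (RtoC (f t / (2 * c)) * (Ci * RtoC L) * T + RtoC (2 * q / (1 + q ^ 2) ^ 2) * th l
        + RtoC (1 / (1 + q ^ 2)) * T))%C
    by (unfold rhs_G, T, rhs_theta, q, L; ring).
  eapply Rle_trans; [apply Cdot_damped_le|].
  { pose proof (pow2_ge_0 L); pose proof (pow2_ge_0 (eta - L * t)).
    assert (0 <= nu * (L ^ 2 + (eta - L * t) ^ 2)) by (apply Rmult_le_pos; lra). lra. }
  apply Rmult_le_compat_l; [apply Cmod_ge_0|].
  assert (hq : 0 < 1 / (1 + q ^ 2)) by (apply Rdiv_lt_0_compat; pose proof (pow2_ge_0 q); lra).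
  assert (h1 : Rabs (f t / (2 * c)) * Rabs L * Cmod T <= 2 * eps * neighbours th G l).
  { apply Cmod_rhs_theta_le; [apply Rmult_le_pos; apply Rabs_pos|].
    intros m hm.
    assert (hd : Rabs (f t / (2 * c)) * Rabs L * Rabs (dd c eta m t) <= 2 * eps)
      by (apply forcing_coefficient_le; auto; lia).
    split; [|exact hd]; eapply Rle_trans; [|exact hd].
    apply Rmult_le_compat_l; [apply Rmult_le_pos; apply Rabs_pos | apply cc_le_dd]. }
  assert (h2 : 1 / (1 + q ^ 2) * Cmod T <= 4 * eps * neighbours th G l).
  { apply Cmod_rhs_theta_le; [lra|].
    intros m hm.
    assert (hd : 1 / (1 + q ^ 2) * Rabs (dd c eta m t) <= 4 * eps)
      by (apply nonresonant_product_le; auto; lia).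
    split; [|exact hd]; eapply Rle_trans; [|exact hd].
    apply Rmult_le_compat_l; [lra | apply cc_le_dd]. }
  assert (h3 : Rabs (2 * q / (1 + q ^ 2) ^ 2) * Cmod (th l) <= w * Cmod (th l)).
  { apply Rmult_le_compat_r; [apply Cmod_ge_0|].
    exact (transport_coefficient_le eta t k heta ht l hl). }
  eapply Rle_trans; [apply Cmod_triangle|].
  eapply Rle_trans; [apply Rplus_le_compat_r, Cmod_triangle|].
  rewrite !Cmod_mult, !Cmod_R, (Rabs_pos_eq (1 / (1 + q ^ 2))) by lra.
  assert (hCi : Cmod Ci = 1).
  { unfold Cmod, Ci; simpl. replace (0 * (0 * 1) + 1 * (1 * 1)) with 1 by ring. apply sqrt_1. }
  rewrite hCi. lra.
Qed.

Lemma G_energy_le (n : nat) :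
  wsum (fun l => lam l ^ 2 * Cdot (G l) (rhs_G nu c eta f th G l t)) n <=
  wnorm lam G n * (24 * eps * (normX lam th + normX lam G) + w * normX lam th).
Proof.
  (* The transport term is written with a zero shift so that [wsum_pairing] applies with [M = 1]. *)
  apply Rle_trans with
    (wsum (fun l => 6 * eps * (lam l ^ 2 * (Cmod (G l) * neighbours th G l)) +
       w * (lam l ^ 2 * (Cmod (G l) * Cmod (th (l + 0)%Z)))) n).
  - apply wsum_le; intros l; rewrite Z.add_0_r.
    pose proof (Rmult_le_compat_l _ _ _ (pow2_ge_0 (lam l)) (Cdot_rhs_G_le l)); lra.
  - rewrite wsum_plus, !wsum_scal.
    assert (he : 0 <= 6 * eps) by (pose proof (eps_pos c eta t k hc heta ht); fold eps in H; lra).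
    pose proof (Rmult_le_compat_l _ _ _ he (wsum_neighbours lam G th G n hlam hth hG)).
    pose proof w_pos as hw.
    assert (h := wsum_pairing lam 1 0 G th n ltac:(lia) ltac:(lra) (proj1 hlam)
      ltac:(intros l; rewrite Z.add_0_r; lra) hth).
    apply (Rmult_le_compat_l w) in h; lra.
Qed.

End Energy.

(** * Window lengths and regularised square roots *)

Lemma exp_le_exp (x y : R) : x <= y -> exp x <= exp y.
Proof. intros [h|h]; [left; now apply exp_increasing | right; now rewrite h]. Qed.

Lemma tres_pos (eta : R) (k : nat) : 0 < eta -> 0 < tres eta k.
Proof.
  intros he; destruct k as [|k]; unfold tres; [lra|].
  assert (0 < eta / INR (S k + 1)) by (apply Rdiv_lt_0_compat; [lra | apply lt_0_INR; lia]).
  assert (0 < eta / INR (S k)) by (apply Rdiv_lt_0_compat; [lra | apply lt_0_INR; lia]).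
  lra.
Qed.

(** The length is [5/4 eta] for [k = 1] and [eta / (k^2 - 1)] for [k >= 2]; the constant [4/3] is
    attained at [k = 2]. *)
Lemma tres_window_length (eta : R) (k : nat) :
  0 < eta -> (1 <= k)%nat ->
  0 <= tres eta (k - 1) - tres eta k <= 4 / 3 * eta / INR k ^ 2.
Proof.
  intros he hk; destruct k as [|[|k]]; [lia| |].
  - simpl; lra.
  - replace (S (S k) - 1)%nat with (S k) by lia; unfold tres.
    rewrite !Nat.add_1_r, !S_INR.
    pose proof (pos_INR k); set (j := INR k) in *.
    replace ((eta / (j + 1 + 1) + eta / (j + 1)) / 2 - (eta / (j + 1 + 1 + 1) + eta / (j + 1 + 1)) / 2)
      with (eta * / ((j + 1) * (j + 3))) by (field; lra).
    split; [apply Rmult_le_pos; [lra|]; left; apply Rinv_0_lt_compat; nra|].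
    replace (4 / 3 * eta / (j + 1 + 1) ^ 2) with (eta * / (3 / 4 * (j + 2) ^ 2)) by (field; lra).
    apply Rmult_le_compat_l; [lra|]; apply Rinv_le_contravar; nra.
Qed.

Lemma sqrt_plus_sqr_le (x e : R) : 0 <= x -> 0 <= e -> sqrt (x + e ^ 2) <= sqrt x + e.
Proof.
  intros hx he; pose proof (sqrt_pos x).
  rewrite <- (sqrt_pow2 (sqrt x + e)) by lra.
  apply sqrt_le_1_alt; rewrite <- (sqrt_sqrt x hx) at 1; nra.
Qed.

(** The left side is the derivative of a regularised norm whose energy has derivative [2 * S]. The
    bound is uniform in [e], and no division by a vanishing norm occurs. *)
Lemma div_sqrt_plus_sqr_le (S x e B : R) :
  0 <= x -> 0 < e -> 0 <= B -> S <= sqrt x * B -> 2 * S / (2 * sqrt (x + e ^ 2)) <= B.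
Proof.
  intros hx he hB h.
  assert (0 < e ^ 2) by now apply pow_lt.
  assert (0 < sqrt (x + e ^ 2)) by (apply sqrt_lt_R0; lra).
  assert (sqrt x <= sqrt (x + e ^ 2)) by (apply sqrt_le_1_alt; lra).
  apply Rmult_le_reg_r with (sqrt (x + e ^ 2)); [assumption|].
  replace (2 * S / (2 * sqrt (x + e ^ 2)) * sqrt (x + e ^ 2)) with S by (field; lra).
  nra.
Qed.

(** * Growth of a solution across one window *)

Section Solution.

Variables (nu c : R) (f : R -> R) (lam : Z -> R) (eta : R) (th G : R -> cseq).
Hypothesis hnu : 0 < nu.
Hypothesis hc : 0 < c.
Hypothesis hf : forall t, 0 <= t -> Rabs (f t) <= 2 * c / (1 + t ^ 2).
Hypothesis hlam : admissible_weight lam.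
Hypothesis heta : 0 < eta.
Hypothesis hsol : is_solution nu c eta f lam th G.

Let N t := normX lam (th t) + normX lam (G t).

Lemma N_continuous (t : R) : 0 < t -> continuous N t.
Proof.
  intros ht; destruct hsol as [_ [hX [hcont _]]].
  apply continuity_pt_filterlim; intros e he.
  destruct (hcont t (Rlt_le _ _ ht) (e / 2)) as [d [hd h]]; [lra|].
  exists (Rmin d t); split; [now apply Rmin_glb_lt|].
  intros s [_ hs]; simpl in hs |- *; unfold Rdist in *.
  assert (Rabs (s - t) < d) by (eapply Rlt_le_trans; [exact hs | apply Rmin_l]).
  assert (h0 : Rabs (s - t) < t) by (eapply Rlt_le_trans; [exact hs | apply Rmin_r]).
  apply Rabs_def2 in h0.
  destruct (h s) as [h1 h2]; [lra | assumption |].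
  destruct (hX s) as [hs1 hs2]; [lra|]; destruct (hX t) as [ht1 ht2]; [lra|].
  assert (p1 := normX_le_plus_minus _ _ _ hs1 ht1); assert (p2 := normX_le_plus_minus _ _ _ ht1 hs1).
  assert (p3 := normX_le_plus_minus _ _ _ hs2 ht2); assert (p4 := normX_le_plus_minus _ _ _ ht2 hs2).
  rewrite normX_minus_sym in p2, p4.
  unfold N; apply Rabs_def1; lra.
Qed.

Lemma is_derive_energy (t : R) (n : nat) : 0 < t ->
  is_derive (fun s => wsum (Xterm lam (th s)) n) t
    (2 * wsum (fun l => lam l ^ 2 * Cdot (th t l) (rhs_theta c eta (th t) (G t) l t)) n) /\
  is_derive (fun s => wsum (Xterm lam (G s)) n) t
    (2 * wsum (fun l => lam l ^ 2 * Cdot (G t l) (rhs_G nu c eta f (th t) (G t) l t)) n).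
Proof.
  intros ht; destruct hsol as [hzero [_ [_ hode]]].
  (* The system is imposed for [l <> 0] only. The zero mode stays 0, so its energy is constant and
     the formula holds with any [z]. *)
  assert (hz : forall (u : R -> cseq) z, (forall s, u s 0%Z = 0%C) ->
    is_derive (fun s => Xterm lam (u s) 0%Z) t (2 * (lam 0%Z ^ 2 * Cdot (u t 0%Z) z))).
  { intros u z hu; rewrite hu.
    apply is_derive_ext with (fun _ => 0).
    - intros s; unfold Xterm; rewrite hu, Cmod_0; simpl; ring.
    - replace (2 * (lam 0%Z ^ 2 * Cdot 0 z)) with 0 by (unfold Cdot; simpl; ring).
      apply (is_derive_const (V := R_NormedModule)). }
  rewrite <- !wsum_scal; split; apply is_derive_wsum; intros l;
    (destruct (Z.eq_dec l 0) as [->|hl]; [apply hz; intros s; apply hzero|]);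
    destruct (hode l hl t ht) as [h1 [h2 [h3 h4]]]; now apply is_derive_Xterm.
Qed.

(** Sum of the two energy bounds: [4 a w + 4 eps] from [th], and [w + 24 eps] from [G]. *)
Definition growth_rate (k : nat) (t : R) : R :=
  (1 + 4 * (c * eta / INR k ^ 3)) * (1 / (1 + (eta / INR k - t) ^ 2)) +
  28 * (4 * c * INR k ^ 2 / eta).

Definition growth_primitive (k : nat) (t : R) : R :=
  (1 + 4 * (c * eta / INR k ^ 3)) * atan (t - eta / INR k) + 28 * (4 * c * INR k ^ 2 / eta) * t.

Lemma is_derive_growth_primitive (k : nat) (t : R) :
  is_derive (growth_primitive k) t (growth_rate k t).
Proof.
  unfold growth_primitive, growth_rate.
  set (a := 1 + _); set (b := 28 * _); set (q := eta / INR k); clearbody a b q.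
  auto_derive; [trivial|].
  pose proof (pow2_ge_0 (q - t)).
  unfold Rsqr; field; nra.
Qed.

Lemma growth_rate_continuous (k : nat) (t : R) : continuous (growth_rate k) t.
Proof.
  apply (ex_derive_continuous (K := R_AbsRing) (V := R_NormedModule)).
  unfold growth_rate; auto_derive.
  pose proof (pow2_ge_0 (eta / INR k - t)); simpl in *; lra.
Qed.

(** Neighbours reach outside the truncation, so the rate involves the full norm [N] and the
    truncated norms satisfy no closed inequality. The integral form survives the limit in [n]. *)
Lemma truncated_growth (k : nat) (t : R) (n : nat) :
  between_resonances eta k t ->
  wnorm lam (th t) n + wnorm lam (G t) n <=
  N (tres eta k) + RInt (fun s => growth_rate k s * N s) (tres eta k) t.
Proof.
  intros ht.
  set (a := tres eta k) in *.
  assert (ha : 0 < a) by now apply tres_pos.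
  assert (hat : a <= t) by apply ht.
  assert (hX := proj1 (proj2 hsol)).
  assert (hW : forall u, 0 <= wsum (Xterm lam u) n)
    by (intros; apply wsum_nonneg, Xterm_nonneg).
  apply le_epsilon; intros e2 he2.
  (* Each of the two regularised square roots costs at most [e] at the initial time. *)
  set (e := e2 / 2); assert (he : 0 < e) by (unfold e; lra).
  set (A s := wsum (Xterm lam (th s)) n); set (B s := wsum (Xterm lam (G s)) n).
  set (F s := sqrt (A s + e ^ 2) + sqrt (B s + e ^ 2) - RInt (fun s => growth_rate k s * N s) a s).
  assert (he3 : 0 < e ^ 2) by now apply pow_lt.
  assert (hF : F t <= F a).
  { set (SA s := wsum (fun l => lam l ^ 2 * Cdot (th s l) (rhs_theta c eta (th s) (G s) l s)) n).
    set (SB s := wsum (fun l => lam l ^ 2 * Cdot (G s l) (rhs_G nu c eta f (th s) (G s) l s)) n).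
    apply (nonincreasing_of_derive_le_0 F (fun s =>
      2 * SA s / (2 * sqrt (A s + e ^ 2)) + 2 * SB s / (2 * sqrt (B s + e ^ 2)) -
      growth_rate k s * N s)); [assumption| |].
    - intros s hs; unfold F.
      destruct (is_derive_energy s n) as [hdA hdB]; [lra|].
      apply (is_derive_minus (K := R_AbsRing) (V := R_NormedModule)).
      + apply (is_derive_plus (K := R_AbsRing) (V := R_NormedModule));
          apply (is_derive_sqrt (fun s => _ + e ^ 2)).
        * rewrite <- (Rplus_0_r (2 * SA s)).
          apply (is_derive_plus (K := R_AbsRing) (V := R_NormedModule));
            [exact hdA | apply (is_derive_const (V := R_NormedModule))].
        * pose proof (hW (th s)); unfold A; lra.
        * rewrite <- (Rplus_0_r (2 * SB s)).
          apply (is_derive_plus (K := R_AbsRing) (V := R_NormedModule));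
            [exact hdB | apply (is_derive_const (V := R_NormedModule))].
        * pose proof (hW (G s)); unfold B; lra.
      + apply (is_derive_RInt_pos (fun s => growth_rate k s * N s)); [|lra|lra].
        intros r hr; apply (continuous_mult (K := R_AbsRing));
          [apply growth_rate_continuous | now apply N_continuous].
    - intros s hs; cbv beta.
      destruct (hX s) as [hx1 hx2]; [lra|].
      assert (hbs : between_resonances eta k s) by (split; [apply ht|]; destruct ht as [_ ht]; fold a; lra).
      destruct (proj1 hsol s) as [hz1 hz2].
      assert (hfs := hf s ltac:(lra)).
      assert (h1 := theta_energy_le c eta lam k s (th s) (G s) hc heta hlam hbs hx1 hx2 n).
      assert (h2 := G_energy_le nu c eta f lam k s (th s) (G s) hnu hc heta hfs hlam hbs hx1 hx2 hz2 n).
      fold (SA s) in h1; fold (SB s) in h2.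
      pose proof (w_pos eta k s) as hw; pose proof (eps_pos c eta s k hc heta hbs) as hep.
      unfold growth_rate, N.
      pose proof (normX_nonneg lam (th s)); pose proof (normX_nonneg lam (G s)).
      assert (hK : 0 < c * eta / INR k ^ 3).
      { apply Rdiv_lt_0_compat; [nra|]; apply pow_lt, lt_0_INR; destruct ht; lia. }
      set (aa := c * eta / INR k ^ 3) in *; set (w := 1 / (1 + (eta / INR k - s) ^ 2)) in *.
      set (ep := 4 * c * INR k ^ 2 / eta) in *.
      apply div_sqrt_plus_sqr_le with (e := e) in h1; [|apply hW | assumption |].
      2: { assert (0 < aa * w) by now apply Rmult_lt_0_compat.
           apply Rmult_le_pos; lra. }
      apply div_sqrt_plus_sqr_le with (e := e) in h2; [|apply hW | assumption |].
      2: { apply Rplus_le_le_0_compat; apply Rmult_le_pos; lra. }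
      fold (A s) in h1; fold (B s) in h2.
      (* Transport produces only [w * normX lam (th s)]; this completes it to [w * N s]. *)
      assert (0 <= w * normX lam (G s)) by (apply Rmult_le_pos; lra).
      lra. }
  assert (hFa : F a <= N a + 2 * e).
  { unfold F; rewrite RInt_point; change (zero : R) with 0.
    pose proof (sqrt_plus_sqr_le (A a) e (hW _) (Rlt_le _ _ he)).
    pose proof (sqrt_plus_sqr_le (B a) e (hW _) (Rlt_le _ _ he)).
    destruct (hX a) as [hx1 hx2]; [lra|].
    pose proof (wnorm_le_normX lam (th a) n hx1); pose proof (wnorm_le_normX lam (G a) n hx2).
    unfold N; unfold wnorm in *; fold (A a) in *; fold (B a) in *. lra. }
  assert (hFt : wnorm lam (th t) n + wnorm lam (G t) n - RInt (fun s => growth_rate k s * N s) a t <= F t).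
  { unfold F, wnorm; fold (A t) (B t).
    assert (sqrt (A t) <= sqrt (A t + e ^ 2)) by (apply sqrt_le_1_alt; lra).
    assert (sqrt (B t) <= sqrt (B t + e ^ 2)) by (apply sqrt_le_1_alt; lra). lra. }
  replace e2 with (2 * e) by (unfold e; field). lra.
Qed.

(** The [atan] in the primitive varies by at most [PI], and the constant part of the rate
    contributes [28 * 16/3 * c <= 150 c] over a window. *)
Lemma growth_between_resonances (k : nat) (t : R) :
  between_resonances eta k t ->
  N t <= exp (PI * (1 + 4 * (c * eta / INR k ^ 3)) + 150 * c) * N (tres eta k).
Proof.
  intros ht.
  assert (hX := proj1 (proj2 hsol)).
  assert (ha : 0 < tres eta k) by now apply tres_pos.
  assert (hK : 0 < INR k) by (apply lt_0_INR; destruct ht; lia).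
  assert (hcK : 0 < c * eta / INR k ^ 3).
  { apply Rdiv_lt_0_compat; [nra|]; now apply pow_lt. }
  (* The truncated inequality in the limit: its right side is independent of [n]. *)
  assert (hint : forall s, tres eta k <= s <= t ->
    N s <= N (tres eta k) + RInt (fun s => growth_rate k s * N s) (tres eta k) s).
  { intros s hs; destruct (hX s) as [hx1 hx2]; [lra|].
    refine (is_lim_seq_le _ _ _ _ _ (is_lim_seq_plus' _ _ _ _ (wnorm_lim lam _ hx1)
      (wnorm_lim lam _ hx2)) (is_lim_seq_const _)).
    intros n; apply truncated_growth; split; [apply ht|]; destruct ht as [_ ht]; lra. }
  assert (h := gronwall N (growth_rate k) (growth_primitive k) (tres eta k) t ha
    (proj1 (proj2 ht)) N_continuous (fun s _ => growth_rate_continuous k s)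
    (is_derive_growth_primitive k)).
  eapply Rle_trans; [apply h; [|exact hint]|].
  - intros s; unfold growth_rate.
    pose proof (w_pos eta k s); pose proof (eps_pos c eta t k hc heta ht).
    apply Rplus_le_le_0_compat; [apply Rmult_le_pos|]; lra.
  - rewrite Rmult_comm; apply Rmult_le_compat_r.
    { unfold N; pose proof (normX_nonneg lam (th (tres eta k)));
      pose proof (normX_nonneg lam (G (tres eta k))); lra. }
    apply exp_le_exp.
    unfold growth_primitive.
    pose proof (atan_bound (t - eta / INR k)); pose proof (atan_bound (tres eta k - eta / INR k)).
    destruct (tres_window_length eta k heta (proj1 ht)) as [_ hlen].
    destruct ht as [hk ht].
    assert (hl : 4 * c * INR k ^ 2 / eta * (t - tres eta k) <= 16 / 3 * c).
    { replace (16 / 3 * c) with (4 * c * INR k ^ 2 / eta * (4 / 3 * eta / INR k ^ 2)) by (field; lra).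
      apply Rmult_le_compat_l; [|lra].
      left; apply Rdiv_lt_0_compat; [|lra].
      apply Rmult_lt_0_compat; [lra | now apply pow_lt]. }
    set (a := c * eta / INR k ^ 3) in *.
    assert ((1 + 4 * a) * (atan (t - eta / INR k) - atan (tres eta k - eta / INR k)) <= (1 + 4 * a) * PI)
      by (apply Rmult_le_compat_l; lra).
    lra.
Qed.

End Solution.

(** * Numerical bounds, cube roots and rounding *)

Lemma PI_lt_315 : PI < 315 / 100.
Proof.
  (* Three terms of the alternating series for [PI / 4 = 2 atan (1/3) + atan (1/7)]. *)
  destruct (PI_2_3_7_ineq 1) as [_ h].
  unfold tg_alt, PI_2_3_7_tg, Ratan_seq in h; simpl in h; lra.
Qed.

Lemma PI_gt_3 : 3 < PI.
Proof. pose proof PI2_3_2; lra. Qed.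

Lemma cbrt_pos (x : R) : 0 < cbrt x.
Proof. apply exp_pos. Qed.

Lemma cbrt_cube (x : R) : 0 < x -> cbrt x ^ 3 = x.
Proof.
  intros hx; rewrite <- Rpower_pow by apply cbrt_pos.
  unfold cbrt; rewrite Rpower_mult.
  replace (1 / 3 * INR 3) with 1 by (simpl; field). now apply Rpower_1.
Qed.

Lemma cube_le_inv (x y : R) : 0 <= y -> x ^ 3 <= y ^ 3 -> x <= y.
Proof.
  intros hy h; destruct (Rle_lt_dec x y) as [|hlt]; [assumption|].
  assert (0 <= y ^ 2) by apply pow2_ge_0.
  assert (0 < x ^ 2 + x * y + y ^ 2) by nra.
  assert (0 < (x - y) * (x ^ 2 + x * y + y ^ 2)) by (apply Rmult_lt_0_compat; lra).
  lra.
Qed.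

Lemma round_nat_bounds (x : R) : 0 < x -> INR (round_nat x) <= x + 1 / 2 < INR (round_nat x) + 1.
Proof.
  intros hx; unfold round_nat.
  destruct (base_Int_part (x + 1 / 2)) as [h1 h2].
  assert (0 <= Int_part (x + 1 / 2))%Z.
  { apply Z.lt_succ_r, lt_IZR; rewrite succ_IZR; lra. }
  rewrite INR_IZR_INZ, Z2Nat.id by assumption; lra.
Qed.

(** The right side is the integral of the convex function [4 / x^3] over [[K - 1/2, K + 1/2]], at
    least its midpoint value. Summed over [K] it telescopes. *)
Lemma inv_cube_le (K : R) : 1 <= K -> 4 / K ^ 3 <= 2 * (/ (K - 1 / 2) ^ 2 - / (K + 1 / 2) ^ 2).
Proof.
  intros hK.
  replace (2 * (/ (K - 1 / 2) ^ 2 - / (K + 1 / 2) ^ 2)) with (4 * K * / (K ^ 2 - 1 / 4) ^ 2)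
    by (field; repeat split; nra).
  replace (4 / K ^ 3) with (4 * K * / (K ^ 2) ^ 2) by (field; lra).
  apply Rmult_le_compat_l; [lra|].
  apply Rinv_le_contravar; [apply pow_lt; nra|].
  apply pow_incr; nra.
Qed.


(** * Chaining the windows and bounding the total exponent *)

Lemma chain (N : nat -> R) (c X : R) (k0 j : nat) :
  0 <= X -> (forall k, 0 <= N k) ->
  (forall k, (1 <= k)%nat -> N (k - 1)%nat <= exp (PI + 4 * X / INR k ^ 3 + 150 * c) * N k) ->
  N k0 <= exp ((PI + 150 * c) * INR j +
    2 * X * (/ (INR k0 + 1 / 2) ^ 2 - / (INR (k0 + j) + 1 / 2) ^ 2)) * N (k0 + j)%nat.
Proof.
  intros hX hN hstep; induction j as [|j IH].
  - rewrite Nat.add_0_r; simpl INR.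
    replace ((PI + 150 * c) * 0 + 2 * X * (/ (INR k0 + 1 / 2) ^ 2 - / (INR k0 + 1 / 2) ^ 2)) with 0 by ring.
    rewrite exp_0; lra.
  - eapply Rle_trans; [exact IH|].
    rewrite Nat.add_succ_r.
    assert (h := hstep (S (k0 + j)) ltac:(lia)).
    replace (S (k0 + j) - 1)%nat with (k0 + j)%nat in h by lia.
    eapply Rle_trans; [apply Rmult_le_compat_l; [left; apply exp_pos | exact h]|].
    rewrite <- Rmult_assoc, <- exp_plus.
    apply Rmult_le_compat_r; [apply hN|]; apply exp_le_exp.
    assert (hK : 1 <= INR (S (k0 + j))) by (apply (le_INR 1); lia).
    (* The new window adds exactly the next term of the telescoping sum. *)
    assert (hc := Rmult_le_compat_l _ _ _ hX (inv_cube_le _ hK)).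
    rewrite (S_INR (k0 + j)) in *; rewrite (S_INR j).
    replace (INR (k0 + j) + 1 - 1 / 2) with (INR (k0 + j) + 1 / 2) in hc by field.
    replace (4 * X / (INR (k0 + j) + 1) ^ 3) with (X * (4 / (INR (k0 + j) + 1) ^ 3))
      by (unfold Rdiv; ring).
    lra.
Qed.

(* [x] and [y] stand for the cube roots of [PI c eta] and [c eta].  The tight case is [k0 = 0], [k1 = 1],
   where [60 PI y] exceeds the leading cost [PI] of one window by about two percent only. *)
Lemma exponent_le (c x y : R) (k0 k1 : nat) :
  0 < c -> c <= 1 / 1000 -> c <= y ^ 3 / 1000 -> 0 < x -> 0 < y -> x ^ 3 = PI * y ^ 3 ->
  INR k0 <= x + 1 / 2 < INR k0 + 1 -> INR k1 <= 20 * x + 1 / 2 < INR k1 + 1 -> (k0 < k1)%nat ->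
  (PI + 150 * c) * (INR k1 - INR k0) + 2 * x ^ 3 * / (INR k0 + 1 / 2) ^ 2 <= 60 * PI * y.
Proof.
  intros hc hc1 hc2 hx hy hxy h0 h1 hk.
  pose proof PI_lt_315 as hP1; pose proof PI_gt_3 as hP3.
  assert (hy3 : 0 < y ^ 3) by now apply pow_lt.
  (* [1.466^3] exceeds [3.15], hence [PI]; then [60 / 1.466 >= 40.9] expresses the target through
     [x]. *)
  assert (hxy' : x <= 1466 / 1000 * y).
  { apply cube_le_inv; [lra|]. rewrite Rpow_mult_distr, hxy.
    apply Rmult_le_compat_r; lra. }
  assert (hy60 : 409 / 10 * PI * x <= 60 * PI * y).
  { apply Rle_trans with (PI * (60 * y)); [|lra].
    apply Rle_trans with (PI * (409 / 10 * x)); [lra|].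
    apply Rmult_le_compat_l; lra. }
  assert (hx3 : 0 < x ^ 3) by now apply pow_lt.
  pose proof (pos_INR k0) as hk0.
  (* Rounding gives [x < k0 + 1/2], so the telescoped sum costs at most [2 x]. *)
  assert (hinv : x ^ 3 * / (INR k0 + 1 / 2) ^ 2 <= x).
  { apply Rle_trans with (x ^ 3 * / x ^ 2); [|right; field; lra].
    apply Rmult_le_compat_l; [lra|].
    apply Rinv_le_contravar; [now apply pow_lt|]; apply pow_incr; lra. }
  (* With at most [27 x] windows the exponent is about [27 PI x + 6 x], well below [40.9 PI x]. *)
  assert (hlarge : INR k1 - INR k0 <= 27 * x ->
    (PI + 150 * c) * (INR k1 - INR k0) + 2 * x ^ 3 * / (INR k0 + 1 / 2) ^ 2 <= 60 * PI * y).
  { intros h.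
    assert (hlt : 1 <= INR k1 - INR k0).
    { rewrite <- minus_INR by lia; apply (le_INR 1); lia. }
    assert ((PI + 150 * c) * (INR k1 - INR k0) <= (PI + 15 / 100) * (27 * x)).
    { apply Rmult_le_compat; lra. }
    assert (3 * x <= PI * x) by (apply Rmult_le_compat_r; lra).
    lra. }
  destruct k0 as [|k0].
  - simpl INR in *.
    destruct (Nat.eq_dec k1 1) as [->|hk1].
    + simpl INR in *.
      assert (hx4 : x ^ 3 <= x * (75 / 1000) ^ 2).
      { replace (x ^ 3) with (x * x ^ 2) by ring.
        apply Rmult_le_compat_l; [lra|]; apply pow_incr; lra. }
      replace (2 * x ^ 3 * / (0 + 1 / 2) ^ 2) with (8 * x ^ 3) by field.
      (* Here [x] can be as small as [1/40], so [150 c <= 0.15] is too weak; [c] is measured against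
         [x^3] instead. *)
      assert (150 * c <= 15 / 100 * x ^ 3) by (rewrite hxy; nra).
      assert (PI * (1 / 40) <= PI * x) by (apply Rmult_le_compat_l; lra).
      assert (3 * x <= PI * x) by (apply Rmult_le_compat_r; lra).
      lra.
    (* [k1 >= 2] forces [x >= 0.075], so the rounding error [1/2] is at most [20/3 x]; this is where
       27 comes from. *)
    + apply hlarge.
      assert (2 <= INR k1) by (apply (le_INR 2); lia). lra.
  (* [k0 >= 1] forces [x >= 1/2], and the difference is below [19 x + 1 <= 21 x]. *)
  - apply hlarge; rewrite S_INR in *.
    pose proof (pos_INR k0). lra.
Qed.

Theorem theorem3p2 (nu c : R) (f : R -> R) (lam : Z -> R) (eta : R)
    (th G : R -> cseq) :
  0 < nu -> 0 < c -> c < 1 / 1000 ->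
  (forall t, 0 <= t -> continuity_pt f t) ->
  (forall t, 0 <= t -> Rabs (f t) <= 2 * c / (1 + t ^ 2)) ->
  admissible_weight lam ->
  1000 <= eta ->
  is_solution nu c eta f lam th G ->
  (forall k : nat,
     cbrt (PI * c * eta) <= INR k <= cbrt (8000 * c * eta * PI) ->
     forall t, tres eta k <= t <= tres eta (k - 1) ->
       normX lam (th t) + normX lam (G t) <=
       exp (3 * PI) * (normX lam (th (tres eta k)) + normX lam (G (tres eta k)))) /\
  (let k0 := round_nat (cbrt (PI * c * eta)) in
   let k1 := round_nat (cbrt (8000 * c * eta * PI)) in
   normX lam (th (tres eta k0)) + normX lam (G (tres eta k0)) <=
   exp (60 * PI * cbrt (c * eta)) *
     (normX lam (th (tres eta k1)) + normX lam (G (tres eta k1)))).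
Proof.
  intros hnu hc hc1 _ hf hlam heta hsol.
  assert (he : 0 < eta) by lra.
  pose proof PI_lt_315 as hP1; pose proof PI_gt_3 as hP3.
  assert (hce : 0 < c * eta) by now apply Rmult_lt_0_compat.
  assert (hpce : 0 < PI * c * eta) by (rewrite Rmult_assoc; apply Rmult_lt_0_compat; lra).
  set (x := cbrt (PI * c * eta)).
  assert (hx : 0 < x) by apply cbrt_pos.
  assert (hx3 : x ^ 3 = PI * c * eta) by now apply cbrt_cube.
  set (N t := normX lam (th t) + normX lam (G t)).
  assert (hN0 : forall t, 0 <= N t).
  { intros t; unfold N; pose proof (normX_nonneg lam (th t)); pose proof (normX_nonneg lam (G t)); lra. }
  (* With [x^3 = PI c eta] the cost [4 PI a] becomes [4 x^3 / k^3], the form used by [chain]. *)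
  assert (hgrow : forall k t, between_resonances eta k t ->
    N t <= exp (PI + 4 * x ^ 3 / INR k ^ 3 + 150 * c) * N (tres eta k)).
  { intros k t ht; rewrite hx3.
    replace (PI + 4 * (PI * c * eta) / INR k ^ 3) with (PI * (1 + 4 * (c * eta / INR k ^ 3)))
      by (unfold Rdiv; ring).
    exact (growth_between_resonances nu c f lam eta th G hnu hc hf hlam he hsol k t ht). }
  split.
  - intros k [hk _] t ht.
    assert (hk0 : (1 <= k)%nat) by (apply INR_lt; simpl; lra).
    eapply Rle_trans; [apply (hgrow k t (conj hk0 ht))|].
    apply Rmult_le_compat_r; [apply hN0|]; apply exp_le_exp.
    (* The lower bound on [k] reads [x <= k]. The exponent is then at most [PI + 4 + 0.15], below
       [3 PI] as [PI > 3]. *)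
    assert (4 * x ^ 3 / INR k ^ 3 <= 4).
    { assert (0 < INR k ^ 3) by (apply pow_lt; lra).
      apply Rmult_le_reg_r with (INR k ^ 3); [assumption|].
      unfold Rdiv; rewrite Rmult_assoc, Rinv_l, Rmult_1_r by lra.
      apply Rmult_le_compat_l; [lra|]; apply pow_incr; lra. }
    lra.
  - intros k0 k1; fold (N (tres eta k0)) (N (tres eta k1)).
    set (y := cbrt (c * eta)).
    assert (hy : 0 < y) by apply cbrt_pos.
    assert (hy3 : y ^ 3 = c * eta) by now apply cbrt_cube.
    (* Because [8000 = 20^3]. *)
    assert (hx20 : cbrt (8000 * c * eta * PI) = 20 * x).
    { pose proof (cbrt_pos (8000 * c * eta * PI)).
      assert (hcube : cbrt (8000 * c * eta * PI) ^ 3 = (20 * x) ^ 3).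
      { rewrite Rpow_mult_distr, hx3, cbrt_cube by lra; ring. }
      apply Rle_antisym; apply cube_le_inv; lra. }
    assert (h0 : INR k0 <= x + 1 / 2 < INR k0 + 1) by now apply round_nat_bounds.
    assert (h1 : INR k1 <= 20 * x + 1 / 2 < INR k1 + 1).
    { unfold k1; rewrite hx20; apply round_nat_bounds; lra. }
    assert (hk : (k0 <= k1)%nat).
    { apply Nat.lt_succ_r, INR_lt; rewrite S_INR; lra. }
    (* For small [c eta] both roundings may coincide; then the claim only needs an exponential at
       least 1. *)
    destruct (Nat.eq_dec k0 k1) as [<-|hne].
    + rewrite <- (Rmult_1_l (N _)) at 1; apply Rmult_le_compat_r; [apply hN0|].
      rewrite <- exp_0; apply exp_le_exp.
      apply Rmult_le_pos; lra.
    + assert (hchain := chain (fun k => N (tres eta k)) c (x ^ 3) k0 (k1 - k0)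
        ltac:(apply pow_le; lra) (fun k => hN0 _)).
      replace (k0 + (k1 - k0))%nat with k1 in hchain by lia.
      eapply Rle_trans; [apply hchain|].
      { intros k hk'; apply hgrow; split; [assumption|].
        destruct (tres_window_length eta k he hk') as [hl _]; lra. }
      apply Rmult_le_compat_r; [apply hN0|]; apply exp_le_exp.
      rewrite minus_INR by assumption.
      assert (hexp : (PI + 150 * c) * (INR k1 - INR k0) + 2 * x ^ 3 * / (INR k0 + 1 / 2) ^ 2 <= 60 * PI * y).
      { apply exponent_le; try lra; [| |lia].
        (* [c <= y^3 / 1000] is the assumption [eta >= 1000] multiplied by [c]. *)
        - rewrite hy3; apply Rmult_le_compat_l with (r := c) in heta; lra.
        - rewrite hy3, hx3; ring. }
      (* The subtracted end term of the telescoping sum is discarded. *)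
      assert (0 <= 2 * x ^ 3 * / (INR k1 + 1 / 2) ^ 2).
      { apply Rmult_le_pos; [pose proof (pow_lt x 3 hx); lra|].
        left; apply Rinv_0_lt_compat, pow_lt; pose proof (pos_INR k1); lra. }
      lra.
Qed.
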